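(* For any integers $K\ge 3$, $n\ge 1$ and $d\ge 1$, $$\mathrm{Sidon}(\mathscr{S}_K(n,\le d))\le C(d,K)\left[\sum_{0\le k\le d}\binom{n+k}{n}\right]^{\frac{d-1}{2d}}$$ for some $C(d,K)>0$ depending only on $d$ and $K$. When $K$ is prime, we may choose $C(d,K)=C_K^{d^2}$, for some constant $C_K$ depending only on $K$.
   Context: $\Omega_K=\{1,\omega,\dots,\omega^{K-1}\}$ with $\omega=e^{2\pi i/K}$; $z^\alpha=z_1^{\alpha_1}\cdots z_n^{\alpha_n}$ for $z\in\Omega_K^n$ and $\alpha\in\{0,1,\dots,K-1\}^n$; $\|f\|_{\Omega_K^n}=\sup_{z\in\Omega_K^n}|f(z)|$. For $\mathscr{S}\subset\{0,1,\dots,K-1\}^n$, the Sidon constant $\mathrm{Sidon}(\mathscr{S})$ is the best (smallest) constant $C>0$ such that $\sum_{\alpha\in\mathscr{S}}|a_\alpha|\le C\big\|\sum_{\alpha\in\mathscr{S}}a_\alpha z^\alpha\big\|_{\Omega_K^n}$ for all complex coefficients $(a_\alpha)_{\alpha\in\mathscr{S}}$. Moreover $$\mathscr{S}_K(n,\le d)=\Big\{\alpha=(\alpha_1,\dots,\alpha_n)\in\{0,1,\dots,K-1\}^n:\ \sum_{j=1}^n\alpha_j\le d\Big\},$$ the sum being a sum of integers (not mod $K$). *)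

(* Defs.v *)
From HB Require Import structures.
From mathcomp Require Import all_boot all_order all_algebra.
From mathcomp Require Import complex.
From mathcomp Require Import all_classical all_reals all_analysis.

Set Implicit Arguments.
Unset Strict Implicit.
Unset Printing Implicit Defensive.

Import Order.TTheory GRing.Theory Num.Theory.
Import numFieldNormedType.Exports.

Local Open Scope classical_set_scope.
Local Open Scope ring_scope.
Local Open Scope complex_scope.

(* The primitive root of unity e^(2 pi i / K). *)
Definition omega (R : realType) (K : nat) : R[i] :=
  cos (2 * pi / K%:R) +i* sin (2 * pi / K%:R).

Definition Omega (R : realType) (K : nat) : set R[i] :=
  [set omega R K ^+ k | k in [set k : nat | (k < K)%N]].

Definition Omegan (R : realType) (K n : nat) : set ('I_n -> R[i]) :=
  [set z | forall j, Omega K (z j)].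

(* Multi-indices in {0, ..., K-1}^n; their entries are integers, not residues
   mod K. *)
Definition mindex (K n : nat) : finType := {ffun 'I_n -> 'I_K}.

Definition monomial (R : realType) (K n : nat) (z : 'I_n -> R[i])
    (alpha : mindex K n) : R[i] :=
  \prod_(j < n) z j ^+ alpha j.

(* [normc] is the R-valued modulus; the supremum is over a finite nonempty set
   when 0 < K. *)
Definition supnorm (R : realType) (K n : nat) (f : ('I_n -> R[i]) -> R[i]) : R :=
  sup [set ComplexField.Normc.normc (f z) | z in @Omegan R K n].

Definition Sidon_bound (R : realType) (K n : nat) (S : {set mindex K n})
    (C : R) : Prop :=
  forall a : mindex K n -> R[i],
    \sum_(alpha in S) ComplexField.Normc.normc (a alpha)
      <= C * supnorm K (fun z => \sum_(alpha in S) a alpha * monomial z alpha).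

(* The infimum is taken in the extended reals, so that the value would be +oo
   (rather than a default real number) if no constant were admissible. *)
Definition Sidon (R : realType) (K n : nat) (S : {set mindex K n}) : \bar R :=
  ereal_inf [set C%:E | C in [set C : R | 0 < C /\ Sidon_bound S C]].

Definition mindex_le (K n d : nat) : {set mindex K n} :=
  [set alpha : mindex K n | (\sum_(j < n) (alpha j : nat) <= d)%N]%SET.

(* Main.v *)
(* Write f = sum_alpha a_alpha z^alpha, and let f_k collect the monomials that
   involve z_k.  Multiplying a_alpha by s ^ #(supp alpha \cap A) is a
   composition of averaging operators, hence does not increase the sup norm for
   0 <= s <= 1.  The result is a polynomial in 1 - s of degree at most d, whose
   linear coefficient is - sum_(k in A) f_k, so this sum is at most
   4^(d^2) ||f||; as A is arbitrary, sum_k |f_k| <= 4 * 4^(d^2) ||f|| pointwise.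
   Averaging over Omega_K^n and using the equivalence of the L^1 and L^2 norms
   on polynomials of degree d (a consequence of hypercontractivity in L^4)
   bounds sum_k (sum_(alpha_k <> 0) |a_alpha|^2)^(1/2).  Cauchy-Schwarz over
   the at most (n + 1)^(d - 1) indices alpha with alpha_k <> 0 then costs the
   factor (n + 1)^((d - 1) / 2), which is of the announced order because
   d! * sum_k binom(n + k, n) >= (n + 1)^d. *)

Require Import Defs.
From mathcomp Require Import all_boot all_order all_algebra.
From mathcomp Require Import complex.
From mathcomp Require Import all_classical all_reals all_analysis.
From mathcomp Require Import ring lra zify.

Import Order.TTheory GRing.Theory Num.Theory.
Import ComplexField.Normc.
Local Open Scope ring_scope.
Local Open Scope complex_scope.

Set Implicit Arguments.
Unset Strict Implicit.
Unset Printing Implicit Defensive.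

(** * Elementary inequalities for finite sums and for the complex modulus *)

Lemma sum_cauchy_schwarz (R : realFieldType) (I : finType) (P : pred I)
    (p q : I -> R) :
  (\sum_(i | P i) p i * q i) ^+ 2
    <= (\sum_(i | P i) p i ^+ 2) * (\sum_(i | P i) q i ^+ 2).
Proof.
rewrite -subr_ge0.
(* By Lagrange's identity this double sum is twice the difference of the two sides. *)
have : 0 <= \sum_(i | P i) \sum_(j | P j) (p i * q j - p j * q i) ^+ 2.
  by apply: sumr_ge0 => i _; apply: sumr_ge0 => j _; exact: sqr_ge0.
have -> : \sum_(i | P i) \sum_(j | P j) (p i * q j - p j * q i) ^+ 2 =
    (\sum_(i | P i) p i ^+ 2) * (\sum_(i | P i) q i ^+ 2)
    + (\sum_(i | P i) q i ^+ 2) * (\sum_(i | P i) p i ^+ 2)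
    - 2 * ((\sum_(i | P i) p i * q i) * (\sum_(i | P i) p i * q i)).
  rewrite !big_distrlr /= mulr_sumr -big_split -sumrB /=.
  apply: eq_bigr => i _; rewrite mulr_sumr -big_split -sumrB /=.
  by apply: eq_bigr => j _; ring.
by rewrite [X in _ + X - _]mulrC; nra.
Qed.

Lemma sqr_sum_le_card (R : realFieldType) (I : finType) (P : pred I)
    (p : I -> R) :
  (\sum_(i | P i) p i) ^+ 2 <= #|P|%:R * \sum_(i | P i) p i ^+ 2.
Proof.
have := sum_cauchy_schwarz P p (fun=> 1).
under eq_bigr do rewrite mulr1.
by under [X in _ <= _ * X]eq_bigr do rewrite expr1n; rewrite sumr_const mulrC.
Qed.

Lemma sum_sqr_le_sqr_sum (R : realFieldType) (I : finType) (P : pred I)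
    (p : I -> R) :
  (forall i, 0 <= p i) ->
  \sum_(i | P i) p i ^+ 2 <= (\sum_(i | P i) p i) ^+ 2.
Proof.
move=> p0; rewrite expr2 mulr_suml; apply: ler_sum => i Pi.
rewrite expr2 ler_wpM2l// (bigD1 i)//= lerDl.
exact: sumr_ge0.
Qed.

Lemma sqr_normcE (R : rcfType) (z : R[i]) :
  normc z ^+ 2 = complex.Re z ^+ 2 + complex.Im z ^+ 2.
Proof. by case: z => a b /=; rewrite sqr_sqrtr// addr_ge0 ?sqr_ge0. Qed.

Lemma normc_ge0 (R : rcfType) (z : R[i]) : 0 <= normc z.
Proof. by case: z => a b /=; exact: sqrtr_ge0. Qed.

Lemma normcR (R : rcfType) (x : R) : normc x%:C = `|x|.
Proof. by rewrite /= expr0n addr0 sqrtr_sqr. Qed.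

Lemma normcX (R : rcfType) (z : R[i]) k : normc (z ^+ k) = normc z ^+ k.
Proof.
by elim: k => [|k IH]; rewrite ?expr0 ?normc1// !exprS normcM IH.
Qed.

Lemma normc_sum (R : rcfType) (I : Type) (s : seq I) (P : pred I)
    (F : I -> R[i]) :
  normc (\sum_(i <- s | P i) F i) <= \sum_(i <- s | P i) normc (F i).
Proof.
elim/big_ind2 : _ => [|x1 x2 y1 y2 h1 h2|//]; first by rewrite normc0.
by rewrite (le_trans (le_normcD _ _))// lerD.
Qed.

Lemma Re_sum (R : rcfType) (I : Type) (s : seq I) (P : pred I)
    (F : I -> R[i]) :
  complex.Re (\sum_(i <- s | P i) F i) = \sum_(i <- s | P i) complex.Re (F i).
Proof. by apply: big_morph => // -[a b] [c d]. Qed.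

Lemma Im_sum (R : rcfType) (I : Type) (s : seq I) (P : pred I)
    (F : I -> R[i]) :
  complex.Im (\sum_(i <- s | P i) F i) = \sum_(i <- s | P i) complex.Im (F i).
Proof. by apply: big_morph => // -[a b] [c d]. Qed.

Lemma Re_le_normc (R : rcfType) (z : R[i]) : `|complex.Re z| <= normc z.
Proof.
rewrite -(@ler_pXn2r _ 2) ?nnegrE ?normc_ge0// sqr_normcE real_normK ?num_real//.
by rewrite lerDl sqr_ge0.
Qed.

Lemma Im_le_normc (R : rcfType) (z : R[i]) : `|complex.Im z| <= normc z.
Proof.
rewrite -(@ler_pXn2r _ 2) ?nnegrE ?normc_ge0// sqr_normcE real_normK ?num_real//.
by rewrite lerDr sqr_ge0.
Qed.

Lemma normc_le_ReIm (R : rcfType) (z : R[i]) :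
  normc z <= `|complex.Re z| + `|complex.Im z|.
Proof.
rewrite -(@ler_pXn2r _ 2) ?nnegrE ?normc_ge0 ?addr_ge0// sqr_normcE.
rewrite sqrrD !real_normK ?num_real// -addrA lerD2l lerDr.
by rewrite mulrn_wge0// mulr_ge0.
Qed.

(** The indices where [r] is nonnegative and those where it is negative are two choices of [A] on
    which no cancellation occurs. *)
Lemma sum_norm_le_subsums (R : realFieldType) (I : finType) (r : I -> R)
    (D : R) :
  (forall A : {set I}, `|\sum_(i in A) r i| <= D) ->
  \sum_i `|r i| <= 2 * D.
Proof.
move=> h; have := h [set i | 0 <= r i]%SET; have := h (~: [set i | 0 <= r i])%SET.
have -> : \sum_i `|r i| = \sum_(i in [set i | 0 <= r i]%SET) r i
    - \sum_(i in (~: [set i | 0 <= r i])%SET) r i.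
  rewrite (bigID (mem [set i | 0 <= r i]%SET)) /= -sumrN; congr (_ + _).
    by apply: eq_bigr => i; rewrite inE => /ger0_norm.
  apply: eq_big => i; first by rewrite !inE.
  by rewrite inE -ltNge => /ltr0_norm.
by rewrite !ler_norml => /andP[h1 _] /andP[_ h2]; lra.
Qed.

(** The real and the imaginary parts each cost the factor 2 of the real case. *)
Lemma sum_normc_le_subsums (R : rcfType) (I : finType) (v : I -> R[i])
    (D : R) :
  (forall A : {set I}, normc (\sum_(i in A) v i) <= D) ->
  \sum_i normc (v i) <= 4 * D.
Proof.
move=> h; have hRe := @sum_norm_le_subsums _ _ (fun i => complex.Re (v i)) D.
have hIm := @sum_norm_le_subsums _ _ (fun i => complex.Im (v i)) D.
apply: (@le_trans _ _ (\sum_i `|complex.Re (v i)| + \sum_i `|complex.Im (v i)|)).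
  by rewrite -big_split; apply: ler_sum => i _; exact: normc_le_ReIm.
have -> : 4 * D = 2 * D + 2 * D by ring.
by apply: lerD; [apply: hRe | apply: hIm] => A;
  rewrite -?Re_sum -?Im_sum (le_trans _ (h A))// ?Re_le_normc// Im_le_normc.
Qed.

(* With [r = Re (u^* h)]: [|u + h|^2 = |u|^2 + 2 r + |h|^2] and
   [2 |r| <= |u|^2 + |h|^2]. *)
Lemma normcD_expr4_le (R : rcfType) (u h : R[i]) (k : R) : normc h <= k ->
  normc (u + h) ^+ 4 <= normc u ^+ 4
    + 4 * normc u ^+ 2 * complex.Re (u^* * h)
    + 8 * (normc u ^+ 2 * k ^+ 2) + 3 * k ^+ 4.
Proof.
move=> hk; have k0 := le_trans (normc_ge0 h) hk.
have hk2 : normc h ^+ 2 <= k ^+ 2 by rewrite ler_pXn2r ?nnegrE ?normc_ge0.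
apply: (@le_trans _ _ (normc u ^+ 4 + 4 * normc u ^+ 2 * complex.Re (u^* * h)
    + 8 * (normc u ^+ 2 * normc h ^+ 2) + 3 * normc h ^+ 4)).
  rewrite !(exprM _ 2 2) !sqr_normcE; case: u h {hk} hk2 => [a b] [c d] /=.
  move=> _; set U := a ^+ 2 + _; set H := c ^+ 2 + _.
  have -> : (a + c) ^+ 2 + (b + d) ^+ 2 = U + 2 * (a * c + b * d) + H.
    by rewrite /U /H; ring.
  have -> : a * c - - b * d = a * c + b * d by ring.
  set r := _ + b * d.
  have r2 : r ^+ 2 <= U * H.
    have -> : U * H = r ^+ 2 + (a * d - b * c) ^+ 2 by rewrite /U /H /r; ring.
    by rewrite lerDl sqr_ge0.
  have U0 : 0 <= U by rewrite addr_ge0 ?sqr_ge0.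
  have H0 : 0 <= H by rewrite addr_ge0 ?sqr_ge0.
  have rUH : 2 * r <= U + H.
    have -> : U + H = 2 * r + ((a - c) ^+ 2 + (b - d) ^+ 2).
      by rewrite /U /H /r; ring.
    by rewrite lerDl addr_ge0 ?sqr_ge0.
  have : 0 <= H * (U + H - 2 * r) by rewrite mulr_ge0// subr_ge0.
  by nra.
rewrite !(exprM _ 2 2) lerD//.
  by rewrite lerD2l ler_wpM2l// ler_wpM2l// sqr_ge0.
by rewrite ler_wpM2l// ler_pXn2r ?nnegrE ?sqr_ge0.
Qed.

(** * Roots of unity *)

Lemma omegaX (R : realType) (K k : nat) :
  omega R K ^+ k = cos (2 * pi / K%:R * k%:R) +i* sin (2 * pi / K%:R * k%:R).
Proof.
elim: k => [|k IH]; first by rewrite mulr0 cos0 sin0.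
rewrite exprS IH /omega; set t := 2 * pi / _.
have -> : t * k.+1%:R = t * k%:R + t by rewrite -[in LHS]natr1 mulrDr mulr1.
rewrite cosD sinD; apply/eqP; rewrite eq_complex /=.
by apply/andP; split; apply/eqP; ring.
Qed.

Lemma normc_omega (R : realType) (K : nat) : normc (omega R K) = 1.
Proof. by rewrite /omega /= cos2Dsin2 sqrtr1. Qed.

Lemma omega_expK (R : realType) (K : nat) : omega R K.+1 ^+ K.+1 = 1.
Proof.
by rewrite omegaX divfK ?pnatr_eq0// mulr_natl cos2pi sin2pi.
Qed.

(** By the double-angle formula the cosine could be 1 only if the sine of [pi * (r / K)] vanished,
    but this half-angle lies strictly between 0 and [pi]. *)
Lemma omegaX_neq1 (R : realType) (K r : nat) :
  (0 < r < K)%N -> omega R K ^+ r != 1.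
Proof.
move=> /andP[r0 rK]; rewrite omegaX; apply/eqP => -[+ _].
have -> : 2 * pi / K%:R * r%:R = (pi * (r%:R / K%:R)) *+ 2 :> R.
  by rewrite -mulr_natl; ring.
rewrite cos_mulr2n => h.
have K0 : (0 < K)%N by exact: leq_ltn_trans rK.
have : 0 < sin (pi * (r%:R / K%:R) : R).
  apply: sin_gt0_pi; rewrite mulr_gt0 ?pi_gt0 ?divr_gt0 ?ltr0n//=.
  by rewrite gtr_pMr ?pi_gt0// ltr_pdivrMr ?ltr0n// mul1r ltr_nat.
have := cos2Dsin2 (pi * (r%:R / K%:R) : R).
by nra.
Qed.

Lemma sum_root_of_unity (F : fieldType) (K : nat) (z : F) :
  z ^+ K = 1 -> z != 1 -> \sum_(y < K) z ^+ y = 0.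
Proof.
move=> zK z1; have := subrX1 z K; rewrite zK subrr => /esym/eqP.
by rewrite mulf_eq0 subr_eq0 (negbTE z1) => /eqP.
Qed.

Lemma sum_omegaX (R : realType) (K : nat) (r : 'I_K.+1) : r != ord0 ->
  \sum_(y < K.+1) (omega R K.+1 ^+ y) ^+ r = 0.
Proof.
move=> r0; under eq_bigr do rewrite -exprM mulnC exprM.
apply: sum_root_of_unity; first by rewrite -exprM mulnC exprM omega_expK expr1n.
by rewrite omegaX_neq1// ltn_ord lt0n r0.
Qed.

Lemma conjc_omega (R : realType) (K : nat) : (omega R K)^* = (omega R K)^-1.
Proof.
have w0 : omega R K != 0.
  by apply/eqP => w0; have := normc_omega R K; rewrite w0 normc0; lra.
apply: (mulfI w0); rewrite divff// /omega; apply/eqP; rewrite eq_complex /=.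
rewrite mulrN opprK -!expr2 cos2Dsin2 eqxx /=.
by apply/eqP; ring.
Qed.

(** Orthogonality of the characters of a cyclic group: the summand is the [y]-th power of
    [w ^+ r / w ^+ s], a root of unity that equals 1 only when [r = s]. *)
Lemma sum_omegaX_conj (R : realType) (K : nat) (r s : 'I_K.+1) :
  \sum_(y < K.+1) (omega R K.+1 ^+ y) ^+ r * ((omega R K.+1 ^+ y) ^+ s)^*
    = if r == s then K.+1%:R else 0.
Proof.
set w := omega R K.+1.
have w0 : w != 0.
  by apply/eqP => w0; have := normc_omega R K.+1; rewrite -/w w0 normc0; lra.
have -> : \sum_(y < K.+1) (w ^+ y) ^+ r * ((w ^+ y) ^+ s)^* =
    \sum_(y < K.+1) (w ^+ r / w ^+ s) ^+ y.
  apply: eq_bigr => y _; have wc : w^* = w^-1 := conjc_omega R K.+1.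
  rewrite [X in _ * X = _](_ : _ = w^-1 ^+ y ^+ s); last by rewrite -wc !rmorphXn.
  rewrite exprMn !exprVn.
  by rewrite -!exprM mulnC [(y * s)%N]mulnC.
case: eqP => [->|/eqP rs].
  rewrite divff ?expf_neq0//; under eq_bigr do rewrite expr1n.
  by rewrite sumr_const card_ord.
have wK m : (w ^+ m) ^+ K.+1 = 1 by rewrite -exprM mulnC exprM omega_expK expr1n.
apply: sum_root_of_unity; first by rewrite exprMn exprVn !wK divr1.
apply/eqP => /(congr1 ( *%R^~ (w ^+ s))); rewrite divfK ?expf_neq0// mul1r => h.
wlog lt_rs : r s rs h / (r < s)%N.
  move=> H; case: (ltngtP r s) => [|sr|/val_inj/eqP]; first exact: H.
    by apply: (H s r) => //; rewrite eq_sym.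
  by rewrite (negbTE rs).
have sr : (0 < s - r < K.+1)%N.
  by rewrite subn_gt0 lt_rs (leq_ltn_trans (leq_subr _ _)).
case/negP: (omegaX_neq1 R sr).
apply/eqP; apply: (@mulIf _ (w ^+ r)); first by rewrite expf_neq0.
by rewrite mul1r -exprD subnK ?h// ltnW.
Qed.

Lemma sqr_normc_conj (R : rcfType) (z : R[i]) :
  (normc z ^+ 2)%:C = z * z^*.
Proof.
rewrite sqr_normcE; case: z => a b; apply/eqP; rewrite eq_complex /=.
by apply/andP; split; apply/eqP; ring.
Qed.

Lemma parseval1 (R : realType) (K : nat) (c : 'I_K.+1 -> R[i]) :
  \sum_(y < K.+1) normc (\sum_(r < K.+1) (omega R K.+1 ^+ y) ^+ r * c r) ^+ 2
    = K.+1%:R * \sum_(r < K.+1) normc (c r) ^+ 2.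
Proof.
apply: (@complexI R); rewrite rmorphM !rmorph_sum /= rmorph_nat.
under eq_bigr do rewrite sqr_normc_conj rmorph_sum big_distrlr /=.
rewrite exchange_big mulr_sumr; apply: eq_bigr => r _.
rewrite exchange_big (bigD1 r)//= [X in _ + X]big1 ?addr0.
  under eq_bigr do rewrite rmorphM /= mulrACA.
  by rewrite -mulr_suml sum_omegaX_conj eqxx sqr_normc_conj.
move=> s /negbTE sr; under eq_bigr do rewrite rmorphM /= mulrACA.
by rewrite -mulr_suml sum_omegaX_conj eq_sym sr mul0r.
Qed.

(** * Hypercontractivity *)

(** Points of [Omegan] are encoded by exponent vectors, so [mindex] indexes both points and
    monomials, and averages over the group are finite sums. *)
Definition unity_point (R : realType) (K n : nat) (x : mindex K n) : 'I_n -> R[i] :=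
  fun j => omega R K ^+ x j.

Definition trigpoly (R : realType) (K n : nat) (a : mindex K n -> R[i])
    (x : mindex K n) : R[i] :=
  \sum_alpha a alpha * monomial (unity_point R x) alpha.

Definition support_size (K n : nat) (alpha : mindex K n) : nat :=
  \sum_(j < n) ((alpha j : nat) != 0)%N.

(** Splits off variable 0, for points and exponents alike; this drives the inductions on [n]. *)
Definition scons (K n : nat) (r : 'I_K) (x : mindex K n) : mindex K n.+1 :=
  [ffun j => if unlift ord0 j is Some j' then x j' else r].

Lemma scons0 (K n : nat) (r : 'I_K) (x : mindex K n) : scons r x ord0 = r.
Proof. by rewrite ffunE unlift_none. Qed.

Lemma scons_lift (K n : nat) (r : 'I_K) (x : mindex K n) j :
  scons r x (lift ord0 j) = x j.
Proof. by rewrite ffunE liftK. Qed.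

Lemma sum_scons (V : nmodType) (K n : nat) (F : mindex K n.+1 -> V) :
  \sum_x F x = \sum_(y < K) \sum_(x : mindex K n) F (scons y x).
Proof.
rewrite pair_big (reindex (fun p : 'I_K * mindex K n => scons p.1 p.2)) //=.
exists (fun x : mindex K n.+1 => (x ord0, [ffun j => x (lift ord0 j)])).
  move=> [y x] _ /=; rewrite scons0; congr (_, _).
  by apply/ffunP => j; rewrite ffunE scons_lift.
move=> x _ /=; apply/ffunP => j; rewrite ffunE.
by case: unliftP => [j'|] ->; rewrite ?ffunE.
Qed.

Lemma sum_mindex0 (V : nmodType) (K : nat) (F : mindex K.+1 0 -> V) :
  \sum_x F x = F [ffun=> ord0].
Proof.
rewrite (big_pred1 [ffun=> ord0])// => x.
by apply/esym/eqP/ffunP => -[].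
Qed.

Lemma monomial0 (R : realType) (K : nat) (z : 'I_0 -> R[i])
    (alpha : mindex K 0) : monomial z alpha = 1.
Proof. by rewrite /monomial big_ord0. Qed.

Lemma monomial_scons (R : realType) (K n : nat) (y r : 'I_K)
    (x alpha : mindex K n) :
  monomial (unity_point R (scons y x)) (scons r alpha)
    = (omega R K ^+ y) ^+ r * monomial (unity_point R x) alpha.
Proof.
rewrite /monomial big_ord_recl /unity_point !scons0; congr (_ * _).
by apply: eq_bigr => j _; rewrite !scons_lift.
Qed.

Lemma support_size_scons (K n : nat) (r : 'I_K) (alpha : mindex K n) :
  support_size (scons r alpha) = (((r : nat) != 0) + support_size alpha)%N.
Proof.
rewrite /support_size big_ord_recl scons0; congr (_ + _)%N.
by apply: eq_bigr => j _; rewrite scons_lift.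
Qed.

Lemma trigpoly_scons (R : realType) (K n : nat) (a : mindex K n.+1 -> R[i])
    (y : 'I_K) (x : mindex K n) :
  trigpoly a (scons y x)
    = \sum_(r < K) (omega R K ^+ y) ^+ r * trigpoly (fun b => a (scons r b)) x.
Proof.
rewrite /trigpoly sum_scons; apply: eq_bigr => r _; rewrite mulr_sumr.
by apply: eq_bigr => b _; rewrite monomial_scons mulrCA.
Qed.

(** The one-variable identity is applied in the new variable with the others frozen, then the
    induction hypothesis to each of its coefficients. *)
Lemma parseval (R : realType) (K n : nat) (a : mindex K.+1 n -> R[i]) :
  \sum_x normc (trigpoly a x) ^+ 2
    = K.+1%:R ^+ n * \sum_alpha normc (a alpha) ^+ 2.
Proof.
elim: n a => [|n IH] a.
  by rewrite mul1r /trigpoly !sum_mindex0 monomial0 mulr1.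
rewrite sum_scons exchange_big /=.
under eq_bigr => x _.
  under eq_bigr do rewrite trigpoly_scons.
  rewrite parseval1.
  over.
rewrite -mulr_sumr exchange_big /= exprS -mulrA sum_scons; congr (_ * _).
by rewrite mulr_sumr; apply: eq_bigr => r _; rewrite IH.
Qed.

Lemma normc_omegaX (R : realType) (K y r : nat) :
  normc ((omega R K ^+ y) ^+ r) = 1.
Proof. by rewrite !normcX normc_omega !expr1n. Qed.

(* [g r] is the coefficient of the [r]-th power of the new variable. *)
Lemma hypercontractive_step (R : realType) (K : nat) (I : finType)
    (g : 'I_K.+1 -> I -> R[i]) (W : 'I_K.+1 -> R) (N : R) :
  0 <= N -> (forall r, 0 <= W r) ->
  (forall r, \sum_x normc (g r x) ^+ 4 <= N * W r ^+ 2) ->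
  \sum_(y < K.+1) \sum_x
      normc (\sum_(r < K.+1) (omega R K.+1 ^+ y) ^+ r * g r x) ^+ 4
    <= K.+1%:R * N * (W ord0
         + (4 * K.+1%:R ^+ 2) * \sum_(r | r != ord0) W r) ^+ 2.
Proof.
move=> N0 W0 gW; set q : R := K.+1%:R.
have q1 : 1 <= q by rewrite ler1n.
set H := \sum_(r | r != ord0) W r.
have H0 : 0 <= H by exact: sumr_ge0.
pose u := g ord0; pose k x := \sum_(r | r != ord0) normc (g r x).
pose h y x := \sum_(r | r != ord0) (omega R K.+1 ^+ y) ^+ r * g r x.
have k0 x : 0 <= k x by apply: sumr_ge0 => r _; exact: normc_ge0.
have hk y x : normc (h y x) <= k x.
  rewrite (le_trans (normc_sum _ _ _))//; apply: ler_sum => r _.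
  by rewrite normcM normc_omegaX mul1r.
(* The sum over [r] has at most [q] terms, and the bound of a squared sum by the sum of squares is
   used twice: [q ^+ 2] from the first, squared, and [q] from the second. *)
have k4 x : k x ^+ 4 <= q ^+ 3 * \sum_(r | r != ord0) normc (g r x) ^+ 4.
  have card_q (p : 'I_K.+1 -> R) :
      (\sum_(r | r != ord0) p r) ^+ 2 <= q * \sum_(r | r != ord0) p r ^+ 2.
    rewrite (le_trans (sqr_sum_le_card _ _))// ler_wpM2r//.
      by apply: sumr_ge0 => r _; exact: sqr_ge0.
    by rewrite ler_nat -[X in (_ <= X)%N]card_ord max_card.
  have h2 : k x ^+ 2 <= q * \sum_(r | r != ord0) normc (g r x) ^+ 2 by exact: card_q.
  have := card_q (fun r => normc (g r x) ^+ 2).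
  under [X in _ <= _ * X]eq_bigr do rewrite -exprM.
  set s2 := \sum_(r | _) _ ^+ 2; set s4 := \sum_(r | _) _ ^+ 4 => h4.
  rewrite (exprM _ 2 2) (@le_trans _ _ ((q * s2) ^+ 2))//.
    by rewrite ler_pXn2r ?nnegrE ?sqr_ge0// (le_trans (sqr_ge0 _) h2).
  by rewrite exprMn [q ^+ 3]exprSr -mulrA ler_wpM2l// sqr_ge0.
have U4 : \sum_x normc (u x) ^+ 4 <= N * W ord0 ^+ 2 by exact: gW.
have K4 : \sum_x k x ^+ 4 <= q ^+ 3 * (N * H ^+ 2).
  apply: (@le_trans _ _ (\sum_x q ^+ 3 * \sum_(r | r != ord0) normc (g r x) ^+ 4)).
    exact: ler_sum.
  rewrite -mulr_sumr ler_wpM2l ?exprn_ge0 ?(le_trans ler01)//.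
  rewrite exchange_big (@le_trans _ _ (\sum_(r | r != ord0) N * W r ^+ 2))//.
    exact: ler_sum.
  by rewrite -mulr_sumr ler_wpM2l// sum_sqr_le_sqr_sum.
(* Cauchy-Schwarz between [U4] and [K4] gives [q] to the power 3/2, rounded up to [q ^+ 2]. *)
have UK : \sum_x normc (u x) ^+ 2 * k x ^+ 2 <= q ^+ 2 * (N * (W ord0 * H)).
  rewrite -(@ler_pXn2r _ 2) ?nnegrE//; last 2 first.
  - by apply: sumr_ge0 => x _; rewrite mulr_ge0 ?sqr_ge0.
  - by rewrite mulr_ge0 ?sqr_ge0// mulr_ge0// mulr_ge0.
  rewrite (le_trans (sum_cauchy_schwarz _ _ _))//.
  under eq_bigr do rewrite -exprM; under [X in _ * X <= _]eq_bigr do rewrite -exprM.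
  apply: (@le_trans _ _ ((N * W ord0 ^+ 2) * (q ^+ 3 * (N * H ^+ 2)))).
    by rewrite ler_pM// sumr_ge0// => x _; rewrite exprn_ge0// normc_ge0.
  have -> : (N * W ord0 ^+ 2) * (q ^+ 3 * (N * H ^+ 2)) =
    q ^+ 3 * (N * (W ord0 * H)) ^+ 2 by ring.
  rewrite [X in _ <= X]exprMn ler_wpM2r ?sqr_ge0// -exprM.
  by rewrite ler_weXn2l.
apply: (@le_trans _ _ (\sum_(y < K.+1) \sum_x (normc (u x) ^+ 4
    + 4 * normc (u x) ^+ 2 * complex.Re ((u x)^* * h y x)
    + 8 * (normc (u x) ^+ 2 * k x ^+ 2) + 3 * k x ^+ 4))).
  apply: ler_sum => y _; apply: ler_sum => x _.
  rewrite (bigD1 ord0)//= expr0 mul1r.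
  exact: (normcD_expr4_le _ (hk y x)).
(* The term linear in [h] disappears after summation over [y]; this is why [W ord0] enters with
   weight exactly 1. *)
have h_mean0 x : \sum_(y < K.+1) h y x = 0.
  rewrite exchange_big big1 // => r r0.
  by rewrite -mulr_suml sum_omegaX// mul0r.
rewrite exchange_big /=.
under eq_bigr => x _.
  rewrite !big_split /= -[X in _ + X + _ + _]mulr_sumr -Re_sum.
  rewrite -[X in complex.Re X]mulr_sumr h_mean0 mulr0 /= mulr0 addr0.
  rewrite !sumr_const card_ord -!mulrnDl.
  rewrite -[_ *+ _]mulr_natl.
  over.
rewrite -mulr_sumr -mulrA ler_wpM2l ?(le_trans ler01)// !big_split /=.
rewrite -!mulr_sumr.
(* What remains is [W ord0 ^+ 2 + 8 q^2 W ord0 H + 3 q^3 H^2], up to the factor [N]. The weight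
   [4 q^2] is chosen to match the middle term when the square is expanded, and [3 q^3 <= 16 q^4]. *)
have : N * H ^+ 2 * q ^+ 3 <= N * H ^+ 2 * q ^+ 4.
  by rewrite ler_wpM2l ?mulr_ge0 ?sqr_ge0// ler_weXn2l.
have : 0 <= N * H ^+ 2 * q ^+ 4.
  by rewrite !mulr_ge0 ?sqr_ge0 ?exprn_ge0 ?ler0n.
move: U4 K4 UK.
have -> : N * (W ord0 + 4 * q ^+ 2 * H) ^+ 2 =
  N * W ord0 ^+ 2 + 8 * (q ^+ 2 * (N * (W ord0 * H))) + 16 * (N * H ^+ 2 * q ^+ 4).
  by ring.
have -> : q ^+ 3 * (N * H ^+ 2) = N * H ^+ 2 * q ^+ 3 by ring.
by lra.
Qed.

(** Induction on the number of variables: a nonzero exponent of the new variable costs one factor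
    [4 (K+1)^2], which is what [support_size] records. *)
Lemma hypercontractive (R : realType) (K n : nat) (a : mindex K.+1 n -> R[i]) :
  \sum_x normc (trigpoly a x) ^+ 4
    <= K.+1%:R ^+ n *
       (\sum_alpha (4 * K.+1%:R ^+ 2) ^+ support_size alpha
                   * normc (a alpha) ^+ 2) ^+ 2.
Proof.
elim: n a => [|n IH] a.
  rewrite mul1r /trigpoly !sum_mindex0 monomial0 mulr1 /support_size big_ord0.
  by rewrite mul1r -exprM.
rewrite !sum_scons.
under eq_bigr do under eq_bigr do rewrite trigpoly_scons.
set B : R := 4 * _ ^+ 2.
pose W (r : 'I_K.+1) := \sum_(alpha : mindex K.+1 n)
  B ^+ support_size alpha * normc (a (scons r alpha)) ^+ 2.
have B0 : 0 <= B by rewrite mulr_ge0// sqr_ge0.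
have W0 r : 0 <= W r.
  by apply: sumr_ge0 => alpha _; rewrite mulr_ge0 ?sqr_ge0 ?exprn_ge0.
have := @hypercontractive_step R K _
  (fun r => trigpoly (fun b => a (scons r b))) W (K.+1%:R ^+ n)
  (exprn_ge0 _ (ler0n _ _)) W0
  (fun r => IH _).
move=> /le_trans; apply; rewrite -exprS ler_wpM2l ?exprn_ge0//.
rewrite le_eqVlt; apply/orP; left; apply/eqP; congr (_ ^+ 2).
rewrite [RHS](bigD1 ord0)//= mulr_sumr; congr (_ + _).
  by apply: eq_bigr => alpha _; rewrite support_size_scons.
apply: eq_bigr => r r0; rewrite mulr_sumr; apply: eq_bigr => alpha _.
by rewrite support_size_scons [(r : nat) != 0%N]r0 add1n [B ^+ _.+1]exprS mulrA.
Qed.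

(* [x^2 <= l x + x^4 / l^2] for all [l > 0], used with [l = 2 B S] where [S^2]
   is the second moment. *)
Lemma L2_le_L1_of_L4 (R : realType) (I : finType) (g : I -> R) (w B S : R) :
  (forall x, 0 <= g x) -> 0 < B -> 0 <= S ->
  \sum_x g x ^+ 2 = w * S ^+ 2 -> \sum_x g x ^+ 4 <= w * (B * S ^+ 2) ^+ 2 ->
  w * S <= 3 * B * \sum_x g x.
Proof.
move=> g0 B0; rewrite le_eqVlt => /predU1P[<- _ _|S0 g2 g4].
  by rewrite mulr0 mulr_ge0 ?sumr_ge0// mulr_ge0// ltW.
set l := 2 * B * S; have l0 : 0 < l by rewrite !mulr_gt0.
have pt x : l ^+ 2 * g x ^+ 2 <= l ^+ 3 * g x + g x ^+ 4.
  have gx := g0 x; case: (leP (g x) l) => gl.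
    have : 0 <= l ^+ 2 * g x * (l - g x).
      by rewrite mulr_ge0 ?subr_ge0// mulr_ge0 ?sqr_ge0.
    have : 0 <= g x ^+ 4 by rewrite exprn_ge0.
    by nra.
  have : 0 <= g x ^+ 2 * ((g x - l) * (g x + l)).
    by rewrite mulr_ge0 ?sqr_ge0// mulr_ge0 ?subr_ge0 ?addr_ge0 ?(ltW gl) ?(ltW l0).
  have : 0 <= l ^+ 3 * g x by rewrite mulr_ge0// exprn_ge0// ltW.
  by nra.
have : l ^+ 2 * \sum_x g x ^+ 2 <= l ^+ 3 * \sum_x g x + \sum_x g x ^+ 4.
  by rewrite !mulr_sumr -big_split; apply: ler_sum => x _; exact: pt.
rewrite g2 => h; have {h} := le_trans h (lerD (lexx _) g4).
set G := \sum_x g x.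
(* For this [l] the fourth moment bound is a quarter of the left side. Absorbing it leaves
   [3 w S <= 8 B G]. *)
have -> : l ^+ 2 * (w * S ^+ 2) = (B ^+ 2 * S ^+ 3) * (4 * (w * S)).
  by rewrite /l; ring.
have -> : l ^+ 3 * G + w * (B * S ^+ 2) ^+ 2 =
    (B ^+ 2 * S ^+ 3) * (8 * B * G + w * S) by rewrite /l; ring.
rewrite ler_pM2l ?mulr_gt0 ?exprn_gt0// => h.
have : 0 <= B * G by rewrite mulr_ge0 ?sumr_ge0// ltW.
by lra.
Qed.

(** When at most [d] variables occur in each monomial, all hypercontractive weights are at most
    [(4 (K+1)^2) ^ d], uniformly in [n]; the fourth moment is then controlled by the second. *)
Lemma L2_le_L1 (R : realType) (K n d : nat) (a : mindex K.+1 n -> R[i]) :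
  (forall alpha, a alpha != 0 -> (support_size alpha <= d)%N) ->
  K.+1%:R ^+ n * Num.sqrt (\sum_alpha normc (a alpha) ^+ 2)
    <= 3 * (4 * K.+1%:R ^+ 2) ^+ d * \sum_x normc (trigpoly a x).
Proof.
move=> ad; have q0 : (0 : R) < K.+1%:R by rewrite ltr0n.
have B0 : (0 : R) < 4 * K.+1%:R ^+ 2 by rewrite mulr_gt0// exprn_gt0.
have S0 : 0 <= \sum_alpha normc (a alpha) ^+ 2.
  by apply: sumr_ge0 => alpha _; exact: sqr_ge0.
apply: L2_le_L1_of_L4; rewrite ?exprn_gt0 ?sqrtr_ge0 ?sqr_sqrtr//.
- by move=> x; exact: normc_ge0.
- exact: parseval.
rewrite (le_trans (hypercontractive _))// ler_wpM2l ?exprn_ge0 ?ler0n//.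
rewrite ler_pXn2r ?nnegrE ?mulr_ge0 ?exprn_ge0 ?(ltW B0)//; last first.
  by apply: sumr_ge0 => x _; rewrite mulr_ge0 ?sqr_ge0 ?exprn_ge0 ?(ltW B0).
rewrite mulr_sumr; apply: ler_sum => alpha _.
have [->|a0] := eqVneq (a alpha) 0; first by rewrite normc0 expr0n !mulr0.
rewrite ler_wpM2r ?sqr_ge0// ler_weXn2l ?ad//.
have : (1 : R) <= K.+1%:R by rewrite ler1n.
by nra.
Qed.

(** * Pointwise bound on the sum of the parts *)

(* Passing from [p t] to [2 ^ (d + 2) * p (t / 2) - p t] cancels the leading
   term and does not decrease the coefficient of degree 1. *)
Lemma coef1_bound (R : realType) (d : nat) (c : nat -> R[i]) (M : R) :
  (forall t : R, 0 <= t <= 1 ->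
     normc (\sum_(i < d.+2) c i * t%:C ^+ i) <= M) ->
  normc (c 1%N) <= 4 ^+ (d.+1 ^ 2) * M.
Proof.
elim: d c M => [|d IH] c M h.
  have h0 : normc (c 0%N) <= M.
    have := h 0; rewrite !big_ord_recr big_ord0 /= add0r rmorph0 expr0 mulr1.
    by rewrite expr1 mulr0 addr0 lexx ler01; apply.
  have h1 : normc (c 0%N + c 1%N) <= M.
    have := h 1; rewrite !big_ord_recr big_ord0 /= add0r rmorph1 !expr1n !mulr1.
    by rewrite lexx ler01; apply.
  have -> : c 1%N = (c 0%N + c 1%N) - c 0%N by rewrite addrC addKr.
  rewrite (le_trans (le_normcD _ _))// normcN.
  by rewrite exp1n expr1; have := normc_ge0 (c 0%N); lra.
have M0 : 0 <= M.
  by rewrite (le_trans (normc_ge0 _) (h 0 _))// lexx ler01.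
(* [e i] is the factor acquired by [c i]: it vanishes at [i = d.+2], and [e 1] is [2 ^ (d + 1) - 1],
   at least 1. *)
pose e : nat -> R := fun i => 2 ^+ d.+2 * 2^-1 ^+ i - 1.
have := IH (fun i => (e i)%:C * c i) ((2 ^+ d.+2 + 1) * M) _.
rewrite normcM normcR => H.
apply: (@le_trans _ _ (`|e 1%N| * normc (c 1%N))).
  rewrite ler_peMl ?normc_ge0// ler_normr; apply/orP; left.
  rewrite /e expr1 exprSr mulfK ?pnatr_eq0// lerBrDr exprS.
  by rewrite -[leLHS]mulr1 ler_pM2l// exprn_ege1// ler1n.
apply: (le_trans (H _)) => [t /andP[t0 t1]|].
  have -> : \sum_(i < d.+2) (e i)%:C * c i * t%:C ^+ i =
     (2 ^+ d.+2)%:C * (\sum_(i < d.+3) c i * (t / 2)%:C ^+ i)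
     - \sum_(i < d.+3) c i * t%:C ^+ i.
    have half i : (t / 2)%:C ^+ i = (2^-1 ^+ i)%:C * t%:C ^+ i.
      by rewrite -!rmorphXn -rmorphM /= exprMn mulrC.
    rewrite mulr_sumr -sumrB [RHS]big_ord_recr /= [X in _ = _ + X](_ : _ = 0).
      rewrite addr0; apply: eq_bigr => i _.
      by rewrite half /e rmorphB rmorph1 rmorphM /=; ring.
    rewrite half [c _ * (_ * _)]mulrCA [X in X - _]mulrA -rmorphM /=.
    by rewrite -exprMn divff// expr1n mul1r subrr.
  rewrite (le_trans (le_normcD _ _))// normcN normcM normcR.
  rewrite ger0_norm ?exprn_ge0// mulrDl mul1r lerD//.
    rewrite ler_wpM2l ?exprn_ge0// h//.
    by apply/andP; split; lra.
  by rewrite h// t0.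
(* The sup bound has grown by [2 ^ (d + 2) + 1], which is below [4 ^ (2 d + 3)], the ratio between
   [4 ^ ((d + 2) ^ 2)] and [4 ^ ((d + 1) ^ 2)]. *)
rewrite mulrA ler_wpM2r// (_ : (d.+2 ^ 2 = d.+1 ^ 2 + (2 * d.+1).+1)%N); last first.
  by rewrite -[d.+2]addn1 sqrnD muln1 exp1n -addnA add1n mulnC.
rewrite exprD ler_wpM2l ?exprn_ge0//.
have -> : (4 : R) = 2 ^+ 2 by rewrite expr2; ring.
rewrite -exprM; apply: (@le_trans _ _ (2 ^+ d.+2 + 2 ^+ d.+2)).
  by rewrite lerD2l exprn_ege1// ler1n.
have -> : 2 ^+ d.+2 + 2 ^+ d.+2 = 2 ^+ d.+3 :> R by rewrite [in RHS]exprS; ring.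
by rewrite ler_weXn2l ?ler1n//; lia.
Qed.

Definition update (K n : nat) (x : mindex K n) (k : 'I_n) (y : 'I_K) :
  mindex K n := [ffun j => if j == k then y else x j].

(** Averaging over one variable is the projection onto the monomials free of it: on the others the
    sum of powers of the root of unity is zero. *)
Lemma sum_monomial_update (R : realType) (K n : nat) (x alpha : mindex K.+1 n)
    (k : 'I_n) :
  \sum_(y < K.+1) monomial (unity_point R (update x k y)) alpha
    = if alpha k == ord0 then K.+1%:R * monomial (unity_point R x) alpha else 0.
Proof.
have E y : monomial (unity_point R (update x k y)) alpha =
    (omega R K.+1 ^+ y) ^+ alpha k *
    \prod_(j < n | j != k) unity_point R x j ^+ alpha j.
  rewrite /monomial (bigD1 k)//= /unity_point ffunE eqxx; congr (_ * _).
  by apply: eq_bigr => j /negbTE jk; rewrite ffunE jk.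
under eq_bigr do rewrite E; rewrite -mulr_suml.
case: eqP => [ak|/eqP ak]; last by rewrite sum_omegaX// mul0r.
rewrite ak; under eq_bigr do rewrite expr0.
rewrite sumr_const card_ord /monomial [in RHS](bigD1 k)//= ak expr0 mul1r.
by rewrite -mulr_natl mulr1.
Qed.

(* Multiplying by [s] the coefficients that involve the [k]-th variable amounts
   to [s] times the identity plus [1 - s] times the averaging over that
   variable. *)
Lemma damp1_bound (R : realType) (K n : nat) (a : mindex K.+1 n -> R[i])
    (M s : R) (k : 'I_n) : 0 <= s <= 1 ->
  (forall x, normc (trigpoly a x) <= M) ->
  forall x, normc (trigpoly
    (fun alpha => (if alpha k == ord0 then 1 else s)%:C * a alpha) x) <= M.
Proof.
move=> /andP[s0 s1] aM x; set q : R := K.+1%:R.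
have q0 : 0 < q by rewrite ltr0n.
have -> : trigpoly (fun alpha =>
      (if alpha k == ord0 then 1 else s)%:C * a alpha) x =
    s%:C * trigpoly a x +
    ((1 - s) / q)%:C * \sum_(y < K.+1) trigpoly a (update x k y).
  rewrite /trigpoly exchange_big !mulr_sumr -big_split; apply: eq_bigr => al _ /=.
  rewrite -mulr_sumr sum_monomial_update; case: eqP => _; last first.
    by rewrite !mulr0 addr0 mulrA.
  have -> : (K.+1%:R : R[i]) = q%:C by rewrite rmorph_nat.
  rewrite [X in _ = _ + X](_ : _ =
    ((1 - s) / q * q)%:C * (a al * monomial (unity_point R x) al)).
    by rewrite divfK ?gt_eqF// rmorphB rmorph1 mul1r; ring.
  by rewrite rmorphM /=; ring.
rewrite (le_trans (le_normcD _ _))// !normcM !normcR (ger0_norm s0).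
rewrite ger0_norm ?divr_ge0 ?subr_ge0 ?(ltW q0)//.
have -> : M = s * M + (1 - s) / q * (q * M).
  by rewrite mulrA divfK ?gt_eqF//; ring.
rewrite lerD ?ler_wpM2l// ?divr_ge0 ?subr_ge0 ?(ltW q0)//.
rewrite (le_trans (normc_sum _ _ _))// (le_trans (ler_sum _ (fun y _ => aM _)))//.
by rewrite sumr_const card_ord -mulr_natl.
Qed.

(** A list lets the damping proceed one variable at a time; for [L = enum A] this is the size of the
    intersection of [A] with the support. *)
Definition support_count (K n : nat) (L : seq 'I_n) (alpha : mindex K.+1 n) :=
  count (fun k => alpha k != ord0) L.

Lemma damp_bound (R : realType) (K n : nat) (a : mindex K.+1 n -> R[i])
    (M s : R) (L : seq 'I_n) : 0 <= s <= 1 ->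
  (forall x, normc (trigpoly a x) <= M) ->
  forall x, normc (trigpoly
    (fun alpha => (s ^+ support_count L alpha)%:C * a alpha) x) <= M.
Proof.
move=> s01 aM; elim: L => [|k L IH] x.
  rewrite (_ : trigpoly _ x = trigpoly a x)//.
  by apply: eq_bigr => al _; rewrite expr0 mul1r.
have := damp1_bound k s01 IH x.
rewrite (_ : trigpoly _ x = trigpoly (fun alpha =>
  (s ^+ support_count (k :: L) alpha)%:C * a alpha) x)//.
apply: eq_bigr => al _; rewrite mulrA -rmorphM /=; congr (_ %:C * _ * _).
by case: eqP => _; rewrite ?mul1r//= exprS.
Qed.

(** The linear coefficient is the derivative at 0. *)
Lemma coef1_onesubX_exp (F : comNzRingType) (c : nat) :
  ((1 - 'X : {poly F}) ^+ c)`_1 = - c%:R.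
Proof.
have -> (p : {poly F}) : p`_1 = p^`().[0].
  by rewrite horner_coef0 coef_deriv.
rewrite deriv_exp derivB derivX -polyC1 derivC sub0r polyC1 hornerMn mulN1r.
by rewrite hornerN horner_exp !hornerE subr0 expr1n mulNrn.
Qed.

(** The coefficients of [f_k]. *)
Definition coef_part (R : realType) (K n : nat) (a : mindex K.+1 n -> R[i])
    (k : 'I_n) (alpha : mindex K.+1 n) : R[i] :=
  if alpha k == ord0 then 0 else a alpha.

Lemma sum_parts_bound (R : realType) (K n d : nat)
    (a : mindex K.+1 n -> R[i]) (M : R) :
  (forall alpha, a alpha != 0 -> (support_size alpha <= d.+1)%N) ->
  (forall x, normc (trigpoly a x) <= M) ->
  forall x, \sum_(k < n) normc (trigpoly (coef_part a k) x)
    <= 4 * (4 ^+ (d.+1 ^ 2) * M).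
Proof.
move=> ad aM x; apply: sum_normc_le_subsums => A.
pose b al := a al * monomial (unity_point R x) al.
pose cnt al := support_count (enum A) (al : mindex K.+1 n).
pose P : {poly R[i]} := \sum_al b al *: (1 - 'X) ^+ cnt al.
have cntd al : a al != 0 -> (cnt al <= d.+1)%N.
  move=> /ad; apply: leq_trans.
  rewrite /cnt /support_count /support_size -sum1_count big_enum_cond /=.
  rewrite big_mkcond [leqLHS]big_mkcond/=.
  by apply: leq_sum => j _; case: (j \in A) => //=; case: eqP.
have sizeP : (size P <= d.+2)%N.
  apply: (leq_trans (size_sum _ _ _)); apply/bigmax_leqP => al _.
  have [a0|a0] := eqVneq (a al) 0; first by rewrite /b a0 mul0r scale0r size_poly0.
  apply: (leq_trans (size_scale_leq _ _)).
  apply: (leq_trans (size_poly_exp_leq _ _)).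
  rewrite ltnS (_ : size _ = 2%N) ?mul1n ?cntd//.
  by rewrite -opprB size_polyN size_XsubC.
have -> : \sum_(k in A) trigpoly (coef_part a k) x = - P`_1.
  rewrite /trigpoly exchange_big coef_sum -sumrN; apply: eq_bigr => al _ /=.
  rewrite coefZ coef1_onesubX_exp mulrN opprK /b /cnt /support_count.
  rewrite -sum1_count natr_sum mulr_sumr big_enum_cond /= big_mkcond.
  rewrite [RHS]big_mkcond /=.
  apply: eq_bigr => k _; rewrite /coef_part; case: (k \in A) => //=.
  by case: eqP => _; rewrite ?mul0r ?mulr1.
rewrite normcN; apply: (@coef1_bound R d (fun i => P`_i)) => t /andP[t0 t1].
rewrite -horner_coef_wide//.
have := @damp_bound R K n a M (1 - t) (enum A) _ aM x.
rewrite subr_ge0 t1 gerBl t0 => /(_ isT).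
rewrite (_ : trigpoly _ x = P.[t%:C])// horner_sum; apply: eq_bigr => al _.
rewrite hornerZ horner_exp !hornerE /b rmorphXn rmorphB rmorph1 /=.
by rewrite -mulrA mulrC.
Qed.

(** * Counting multi-indices *)

(** If [beta k] is already maximal, [inord] returns a default value. This is harmless: only the fact
    that the image covers the multi-indices with nonzero [k]-th entry matters. *)
Definition increment (K n : nat) (k : 'I_n) (beta : mindex K.+1 n) :
  mindex K.+1 n := [ffun j => if j == k then inord (beta j).+1 else beta j].

Lemma mindex_le_incrementP (K n e : nat) (k : 'I_n) (alpha : mindex K.+1 n) :
  alpha \in mindex_le K.+1 n e.+1 -> alpha k != ord0 ->
  exists2 beta, beta \in mindex_le K.+1 n e & alpha = increment k beta.
Proof.
rewrite inE => ae ak; have ak0 : (0 < alpha k)%N by rewrite lt0n.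
have prK : ((alpha k).-1 < K.+1)%N by rewrite (leq_ltn_trans (leq_pred _)).
pose beta : mindex K.+1 n :=
  [ffun j => if j == k then inord (alpha j).-1 else alpha j].
exists beta; last first.
  apply/ffunP => j; rewrite !ffunE; case: eqP => [->|//].
  by apply: val_inj; rewrite /= inordK inordK// prednK.
rewrite inE -ltnS; apply: leq_trans ae.
rewrite (bigD1 k)//= [leqRHS](bigD1 k)//= ffunE eqxx inordK// -addSn prednK//.
by rewrite leq_add2l; apply: leq_sum => j /negbTE jk; rewrite ffunE jk.
Qed.

Lemma card_mindex_le (K n e : nat) : (#|mindex_le K.+1 n e| <= n.+1 ^ e)%N.
Proof.
have zero_sum (alpha : mindex K.+1 n) : (forall k, alpha k == ord0) ->
    (\sum_(j < n) alpha j = 0)%N.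
  by move=> a0; rewrite big1// => j _; rewrite (eqP (a0 j)).
elim: e => [|e IH].
  rewrite expn0 -(cards1 ([ffun=> ord0] : mindex K.+1 n)) subset_leq_card//.
  apply/fintype.subsetP => alpha; rewrite !inE leqn0 sum_nat_eq0 => /forallP a0.
  by apply/eqP/ffunP => j; rewrite ffunE; apply/val_inj/eqP/(a0 j).
(* The [n] increments, plus [None] to reach the zero multi-index, make [n.+1] choices per unit of
   degree. *)
pose g (p : option 'I_n * mindex K.+1 n) :=
  if p.1 is Some k then increment k p.2 else p.2.
have sub : mindex_le K.+1 n e.+1 \subset 
      g @: finset.setX [set: option 'I_n]%SET (mindex_le K.+1 n e).
  apply/fintype.subsetP => alpha ale.
  have [/existsP[k ak]|] := boolP [exists k, alpha k != ord0].
    have [beta be ->] := mindex_le_incrementP ale ak.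
    by apply/imsetP; exists (Some k, beta) => //; rewrite !inE /= in be *.
  rewrite negb_exists => /forallP a0; apply/imsetP; exists (None, alpha) => //.
  by rewrite !inE /= zero_sum// => k; have := a0 k; rewrite negbK.
rewrite (leq_trans (subset_leq_card sub))// (leq_trans (leq_imset_card _ _))//.
by rewrite cardsX finset.cardsT card_option card_ord expnS leq_mul2l IH orbT.
Qed.

(** Only the increment at the fixed [k] is needed, which saves one factor [n.+1]. *)
Lemma card_mindex_le_part (K n e : nat) (k : 'I_n) :
  (#|[set alpha in mindex_le K.+1 n e.+1 | alpha k != ord0]| <= n.+1 ^ e)%N.
Proof.
apply: leq_trans (card_mindex_le K n e).
apply: leq_trans (leq_imset_card (increment k) _).
apply/subset_leq_card/fintype.subsetP => alpha; rewrite inE => /andP[ale ak].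
by have [beta be ->] := mindex_le_incrementP ale ak; exact: imset_f.
Qed.

(** The term [k = d] suffices: [d! * binom(n + d, n)] is the product of [n + 1, ..., n + d]. *)
Lemma expn_le_fact_sum_bin (n d : nat) :
  (n.+1 ^ d <= d`! * \sum_(0 <= k < d.+1) 'C(n + k, n))%N.
Proof.
apply: (@leq_trans (d`! * 'C(n + d, n))); last first.
  by rewrite leq_mul2l big_nat_recr//= leq_addl orbT.
rewrite -bin_sub ?leq_addr// addKn mulnC bin_ffact.
elim: d => // d IH; rewrite addnS ffactSS expnS leq_mul//.
by rewrite ltnS leq_addr.
Qed.

(** Lets the factorial be absorbed into a constant of the form [c ^ (d ^ 2)]. *)
Lemma fact_le_exp2 (d : nat) : (d`! <= 2 ^ (d ^ 2))%N.
Proof.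
elim: d => // d IH; rewrite factS.
apply: (@leq_trans (2 ^ d.+1 * 2 ^ (d ^ 2))).
  by rewrite leq_mul// ltnW// ltn_expl.
by rewrite -expnD leq_exp2l// -[in leqRHS]addn1 sqrnD; lia.
Qed.

(** With [t = d / (2 (d + 1))], the left side is the [t]-th power of [(n + 1) ^ (d + 1)], to which
    the binomial bound applies. As [t <= 1], the [t]-th power of the factorial is at most the
    factorial. *)
Lemma sqrt_expn_le_powR (R : realType) (n d : nat) :
  Num.sqrt (n.+1%:R ^+ d) <= (d.+1)`!%:R *
    (\sum_(0 <= k < d.+2) 'C(n + k, n))%N%:R
      `^ ((d.+1%:R - 1) / (2 * d.+1%:R)) :> R.
Proof.
set T := (\sum_(0 <= k < _) _)%N; set t : R := _ / _.
have d0 : (d.+1%:R : R) != 0 by rewrite pnatr_eq0.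
have t0 : 0 <= t by rewrite divr_ge0 ?subr_ge0 ?ler1n// mulr_ge0.
have t1 : t <= 1.
  rewrite ler_pdivrMr ?mulr_gt0 ?ltr0n// mul1r.
  by have : (0 : R) <= d.+1%:R by []; lra.
have -> : Num.sqrt (n.+1%:R ^+ d) = (n.+1%:R ^+ d.+1) `^ t :> R.
  rewrite -powR12_sqrt ?exprn_ge0// -!powR_mulrn// -!powRrM; congr (_ `^ _).
  by rewrite /t -[in RHS]natr1 addrK; field.
rewrite (@le_trans _ _ ((d.+1`! * T)%N%:R `^ t))//.
  by rewrite ge0_ler_powR ?nnegrE ?exprn_ge0// -natrX ler_nat expn_le_fact_sum_bin.
rewrite natrM powRM// ler_wpM2r ?powR_ge0//.
rewrite -[leRHS]powRr1// ler_powR//.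
by rewrite ler1n fact_gt0.
Qed.

(** * The Sidon constant *)

Lemma support_size_le_sum (K n : nat) (alpha : mindex K n) :
  (support_size alpha <= \sum_(j < n) alpha j)%N.
Proof. by apply: leq_sum => j _; case: (nat_of_ord _). Qed.

Lemma normc_monomial (R : realType) (K n : nat) (z : 'I_n -> R[i])
    (alpha : mindex K n) : (@Omegan R K n z) -> normc (monomial z alpha) = 1.
Proof.
move=> zO; rewrite /monomial.
elim/big_ind : _ => [|x y hx hy|j _]; first exact: normc1.
  by rewrite normcM hx hy mulr1.
by have [m _ <-] := zO j; rewrite normc_omegaX.
Qed.

Lemma unity_point_Omegan (R : realType) (K n : nat) (x : mindex K n) :
  @Omegan R K n (unity_point R x).
Proof. by move=> j; exists (x j : nat) => //=. Qed.

Lemma le_supnorm (R : realType) (K n : nat) (S : {set mindex K n})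
    (a : mindex K n -> R[i]) (x : mindex K n) :
  normc (\sum_(alpha in S) a alpha * monomial (unity_point R x) alpha)
    <= supnorm K (fun z => \sum_(alpha in S) a alpha * monomial z alpha).
Proof.
apply: sup_upper_bound; last first.
  by exists (unity_point R x) => //; exact: unity_point_Omegan.
split; first by eexists; exists (unity_point R x) => //; exact: unity_point_Omegan.
(* An upper bound must be exhibited, since [sup] of an unbounded set is a default value. *)
exists (\sum_(alpha in S) normc (a alpha)) => _ [z zO <-].
rewrite (le_trans (normc_sum _ _ _))//; apply: ler_sum => al _.
by rewrite normcM normc_monomial// mulr1.
Qed.

(** By Parseval a single squared coefficient is at most the mean of the squared modulus. *)
Lemma coef_le_sup (R : realType) (K n : nat) (a : mindex K.+1 n -> R[i]) (M : R)
    (alpha : mindex K.+1 n) :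
  (forall x, normc (trigpoly a x) <= M) -> normc (a alpha) <= M.
Proof.
move=> aM; have M0 := le_trans (normc_ge0 _) (aM alpha).
have q0 : (0 : R) < K.+1%:R ^+ n by rewrite exprn_gt0// ltr0n.
rewrite -(@ler_pXn2r _ 2) ?nnegrE ?normc_ge0//.
rewrite -(ler_pM2l q0) (@le_trans _ _ (\sum_x normc (trigpoly a x) ^+ 2))//.
  rewrite parseval ler_pM2l// (bigD1 alpha)//= lerDl.
  by apply: sumr_ge0 => b _; exact: sqr_ge0.
rewrite (@le_trans _ _ (\sum_(x : mindex K.+1 n) M ^+ 2))//.
  by apply: ler_sum => x _; rewrite ler_pXn2r ?nnegrE ?normc_ge0.
by rewrite sumr_const card_ffun !card_ord -[leLHS]mulr_natl natrX.
Qed.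

Lemma sum_coef_part_bound (R : realType) (K n d : nat)
    (a : mindex K.+1 n -> R[i]) (k : 'I_n) :
  (forall alpha, alpha \notin mindex_le K.+1 n d.+1 -> a alpha = 0) ->
  K.+1%:R ^+ n * \sum_alpha normc (coef_part a k alpha)
    <= Num.sqrt (n.+1%:R ^+ d) * (3 * (4 * K.+1%:R ^+ 2) ^+ d.+1)
       * \sum_x normc (trigpoly (coef_part a k) x).
Proof.
move=> aS; set ak := coef_part a k; rewrite -mulrA.
have akS alpha : ak alpha != 0 ->
    alpha \in [set alpha in mindex_le K.+1 n d.+1 | alpha k != ord0]%SET.
  rewrite /ak /coef_part inE; case: (alpha k == ord0); first by rewrite eqxx.
  by rewrite andbT; case: (boolP (alpha \in _)) => // /aS ->; rewrite eqxx.
have := @L2_le_L1 R K n d.+1 ak _.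
set L1 := \sum_x _ => H.
(* Through the L^2 norm: Cauchy-Schwarz on the coefficients of the part comes below it, the
   comparison with L^1 above it. *)
apply: (@le_trans _ _ (Num.sqrt (n.+1%:R ^+ d) *
    (K.+1%:R ^+ n * Num.sqrt (\sum_alpha normc (ak alpha) ^+ 2)))); last first.
  rewrite ler_wpM2l ?sqrtr_ge0// H// => alpha /akS; rewrite !inE => /andP[ale _].
  exact: leq_trans (support_size_le_sum _) ale.
rewrite mulrCA ler_wpM2l ?exprn_ge0//.
rewrite -sqrtrM ?exprn_ge0// -(@ler_pXn2r _ 2) ?nnegrE ?sqrtr_ge0//; last first.
  by apply: sumr_ge0 => alpha _; exact: normc_ge0.
have s0 : 0 <= \sum_alpha normc (ak alpha) ^+ 2.
  by apply: sumr_ge0 => alpha _; exact: sqr_ge0.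
rewrite sqr_sqrtr ?mulr_ge0 ?exprn_ge0//.
rewrite (bigID [in [set alpha in mindex_le K.+1 n d.+1 | alpha k != ord0]%SET]) /=.
rewrite [X in _ + X]big1 ?addr0 => [|alpha aN]; last first.
  rewrite (_ : ak alpha = 0) ?normc0//; apply/eqP.
  by apply: contraNT aN => /akS.
rewrite (le_trans (sqr_sum_le_card _ _))// ler_pM//.
- by apply: sumr_ge0 => alpha _; exact: sqr_ge0.
- by rewrite -natrX ler_nat card_mindex_le_part.
rewrite [leRHS](bigID [in [set alpha in mindex_le K.+1 n d.+1 | alpha k != ord0]%SET]) /=.
by rewrite lerDl; apply: sumr_ge0 => alpha _; exact: sqr_ge0.
Qed.

(** The [1] pays for the constant coefficient; [12] is the 3 of [L2_le_L1] times the 4 of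
    [sum_parts_bound]. *)
Lemma Sidon_bound_mindex_le (R : realType) (K n d : nat) :
  Sidon_bound (mindex_le K.+1 n d.+1)
    (1 + 12 * (4 * K.+1%:R ^+ 2) ^+ d.+1 * 4 ^+ (d.+1 ^ 2)
         * Num.sqrt (n.+1%:R ^+ d) : R).
Proof.
move=> a; set S := mindex_le _ _ _; set M := supnorm _ _.
pose a' alpha := if alpha \in S then a alpha else 0.
have a'S alpha : alpha \notin S -> a' alpha = 0 by rewrite /a' => /negbTE ->.
have a'M x : normc (trigpoly a' x) <= M.
  rewrite (_ : trigpoly a' x =
    \sum_(alpha in S) a alpha * monomial (unity_point R x) alpha) ?le_supnorm//.
  rewrite /trigpoly [RHS]big_mkcond; apply: eq_bigr => alpha _.
  by rewrite /a'; case: ifP => // _; rewrite mul0r.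
have -> : \sum_(alpha in S) normc (a alpha) = \sum_alpha normc (a' alpha).
  rewrite big_mkcond; apply: eq_bigr => alpha _.
  by rewrite /a'; case: ifP => // _; rewrite normc0.
pose part k := coef_part a' k.
pose zero : mindex K.+1 n := [ffun=> ord0].
apply: (@le_trans _ _ (normc (a' zero) + \sum_k \sum_alpha normc (part k alpha))).
  rewrite exchange_big (bigD1 zero)//= lerD2l [leRHS](bigD1 zero)//=.
  rewrite -[leLHS]add0r lerD ?sumr_ge0// => [k _|]; first exact: normc_ge0.
  (* A nonzero multi-index has a nonzero entry, so its coefficient appears in at least one part. *)
  apply: ler_sum => alpha /eqP alpha0.
  have [k ak] : exists k, alpha k != ord0.
    apply/existsP; apply: contra_notT alpha0; rewrite negb_exists => /forallP h.
    by apply/ffunP => j; rewrite ffunE; apply/eqP; have := h j; rewrite negbK.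
  rewrite (bigD1 k)//= {1}/part /coef_part (negbTE ak) lerDl.
  by apply: sumr_ge0 => j _; exact: normc_ge0.
rewrite mulrDl mul1r lerD ?coef_le_sup//.
have q0 : (0 : R) < K.+1%:R ^+ n by rewrite exprn_gt0// ltr0n.
rewrite -(ler_pM2l q0) mulr_sumr.
have parts := sum_parts_bound _ a'M.
apply: (@le_trans _ _ (Num.sqrt (n.+1%:R ^+ d) * (3 * (4 * K.+1%:R ^+ 2) ^+ d.+1)
    * \sum_k \sum_x normc (trigpoly (part k) x))).
  rewrite mulr_sumr; apply: ler_sum => k _.
  exact: sum_coef_part_bound.
have -> : K.+1%:R ^+ n * (12 * (4 * K.+1%:R ^+ 2) ^+ d.+1 * 4 ^+ (d.+1 ^ 2) *
      Num.sqrt (n.+1%:R ^+ d) * M) =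
    Num.sqrt (n.+1%:R ^+ d) * (3 * (4 * K.+1%:R ^+ 2) ^+ d.+1)
    * (K.+1%:R ^+ n * (4 * (4 ^+ (d.+1 ^ 2) * M))) :> R by ring.
rewrite ler_wpM2l// ?mulr_ge0 ?sqrtr_ge0 ?exprn_ge0 ?mulr_ge0//.
rewrite exchange_big.
apply: (@le_trans _ _ (\sum_(x : mindex K.+1 n) 4 * (4 ^+ (d.+1 ^ 2) * M))).
  apply: ler_sum => x _; apply: parts => alpha a0.
  apply: (leq_trans (support_size_le_sum _)).
  have : alpha \in S by apply: contraNT a0 => /a'S ->.
  by rewrite inE.
by rewrite sumr_const card_ffun !card_ord -[leLHS]mulr_natl natrX.
Qed.

Theorem proposition3 (R : realType) :
  exists (C : nat -> nat -> R) (c : nat -> R),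
    [/\ forall d K : nat, (3 <= K)%N -> (1 <= d)%N -> 0 < C d K,
        forall d K : nat, (3 <= K)%N -> (1 <= d)%N -> prime K ->
          C d K = c K ^+ (d ^ 2)
      & forall K n d : nat, (3 <= K)%N -> (1 <= n)%N -> (1 <= d)%N ->
          (Sidon R (mindex_le K n d)
             <= (C d K * ((\sum_(0 <= k < d.+1) 'C(n + k, n))%N%:R
                            `^ ((d%:R - 1) / (2 * d%:R))))%:E)%E].
Proof.
(* [512 K^2 = 16 * (4 K^2) * 4 * 2]: the base of the hypercontractive weights, that of
   [coef1_bound], that of the factorial bound, and 16 for the numerical factor 13. *)
pose c K : R := 512 * K%:R ^+ 2.
have c0 K : (3 <= K)%N -> 0 < c K.
  by move=> K3; rewrite mulr_gt0// exprn_gt0// ltr0n (leq_trans _ K3).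
exists (fun d K => c K ^+ (d ^ 2)), c; split => [d K K3 _|//|].
  by rewrite exprn_gt0// c0.
move=> [//|K] n [//|d] K3 _ _.
set T := (\sum_(0 <= k < _) _)%N; set t : R := _ / _.
(* This allows the additive [1] for the constant coefficient to be multiplied by the binomial
   factor. *)
have T1 : (1 : R) <= T%:R `^ t.
  rewrite -[leLHS](powRr0 (T%:R : R)) ler_powR//.
    by rewrite ler1n /T big_nat_recl// addn0 binn.
  by rewrite divr_ge0 ?subr_ge0 ?ler1n// mulr_ge0.
have q1 : (1 : R) <= K.+1%:R ^+ 2 by rewrite exprn_ege1// ler1n.
have cT0 : 0 < c K.+1 ^+ (d.+1 ^ 2) * T%:R `^ t.
  by rewrite mulr_gt0 ?exprn_gt0 ?c0 ?(lt_le_trans ltr01).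
apply: ereal_inf_lbound; exists (c K.+1 ^+ (d.+1 ^ 2) * T%:R `^ t) => //.
split=> // a; apply: (le_trans (@Sidon_bound_mindex_le R K n d a)).
rewrite ler_wpM2r//.
  by rewrite (le_trans (normc_ge0 _) (le_supnorm _ _ [ffun=> ord0])).
set B := 4 * K.+1%:R ^+ 2; set e := (d.+1 ^ 2)%N.
have B1 : 1 <= B by rewrite /B; lra.
have B0 : 0 <= B := le_trans ler01 B1.
have X0 : (0 : R) <= 12 * B ^+ d.+1 * 4 ^+ e.
  by rewrite !mulr_ge0 ?exprn_ge0.
apply: (@le_trans _ _ (1 + 12 * B ^+ d.+1 * 4 ^+ e * ((d.+1)`!%:R * T%:R `^ t))).
  by rewrite lerD2l ler_wpM2l// sqrt_expn_le_powR.
apply: (@le_trans _ _ ((1 + 12 * B ^+ d.+1 * 4 ^+ e * (d.+1)`!%:R) * T%:R `^ t)).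
  by rewrite [leRHS]mulrDl mul1r -[X in _ <= _ + X]mulrA lerD2r.
rewrite ler_wpM2r ?powR_ge0//.
have Be : B ^+ d.+1 <= B ^+ e by rewrite ler_weXn2l// /e -mulnn leq_pmulr.
have fe : (d.+1)`!%:R <= (2 : R) ^+ e by rewrite -natrX ler_nat fact_le_exp2.
(* [13 = 1 + 12], and [13 <= 16 <= 16 ^ e] because [e] is at least 1. *)
apply: (@le_trans _ _ (13 * (B ^+ e * 4 ^+ e * 2 ^+ e))).
  have : B ^+ d.+1 * 4 ^+ e * (d.+1)`!%:R <= B ^+ e * 4 ^+ e * 2 ^+ e.
    by rewrite !ler_pM ?mulr_ge0 ?exprn_ge0.
  have : 1 <= B ^+ e * 4 ^+ e * 2 ^+ e.
    by rewrite !mulr_ege1 ?exprn_ege1 ?ler1n.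
  by rewrite -!mulrA; lra.
have -> : c K.+1 = 16 * (B * 4 * 2) by rewrite /c /B; ring.
rewrite !exprMn ler_wpM2r ?mulr_ge0 ?exprn_ge0//.
apply: (@le_trans _ _ (16 ^+ 1)); first by rewrite expr1 ler_nat.
by rewrite ler_weXn2l ?ler1n.
Qed.
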